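(* Let $n$ be a positive integer. For every $z \in \mathbb{C}$, $$\sum_{\lambda \vdash n} \ \prod_{h \in \mathcal{H}(\lambda)^{\diamond}} \left( \frac{h+z}{h} \right) = \sum_{\lambda \vdash n} \ \prod_{h \in \mathcal{H}(\lambda)} \left( \frac{h^2+z}{h^2} \right),$$ where $\mathcal{H}(\lambda)$ is the multiset of all hook lengths of the partition $\lambda$ and $\mathcal{H}(\lambda)^{\diamond}$ is the multiset of hook lengths of those cells of $\lambda$ that have trivial leg.
   Context: A partition $\lambda \vdash n$ is a finite weakly decreasing sequence $\lambda = (\lambda_1, \ldots, \lambda_l)$ of positive integers with sum $n$; it is represented by its Young diagram (left-justified rows, the $i$-th row from the top having $\lambda_i$ cells). For a cell $u$ of the diagram, the arm $a_u(\lambda)$ is the number of cells in the same row as $u$ strictly to the right of $u$, the leg $\ell_u(\lambda)$ is the number of cells in the same column as $u$ strictly below $u$, and the hook length is $h_u(\lambda) = a_u(\lambda) + \ell_u(\lambda) + 1$. $\mathcal{H}(\lambda)$ is the multiset of the hook lengths $h_u(\lambda)$ over all cells $u$ of $\lambda$. $\mathcal{H}(\lambda)^{\diamond}$ is the multiset of the hook lengths $h_u(\lambda)$ over all cells $u$ with trivial leg, i.e. $\ell_u(\lambda) = 0$. Products over multisets are taken with multiplicity. *)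

(* Defs.v *)
From HB Require Import structures.
From mathcomp Require Import all_boot all_order all_algebra.
From mathcomp Require Import all_reals.
From mathcomp Require Import complex.

Set Implicit Arguments.
Unset Strict Implicit.
Unset Printing Implicit Defensive.

Definition is_partition (n : nat) (s : seq nat) : bool :=
  [&& sorted geq s, all (leq 1) s & sumn s == n].

Record intpart (n : nat) : Type := IntPart {
  parts :> seq nat;
  partsP : is_partition n parts
}.

HB.instance Definition _ (n : nat) := [isSub for @parts n].
HB.instance Definition _ (n : nat) := [Countable of intpart n by <:].

Lemma leq_sumn_part (s : seq nat) (k : nat) : k \in s -> k <= sumn s.
Proof.
elim: s => //= a s IHs; rewrite inE => /orP[/eqP-> | /IHs le_ks].
  exact: leq_addr.
exact: leq_trans le_ks (leq_addl _ _).
Qed.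

Lemma size_leq_sumn (s : seq nat) : all (leq 1) s -> size s <= sumn s.
Proof.
by elim: s => //= a s IHs /andP[a_gt0 /IHs le_s]; rewrite -add1n leq_add.
Qed.

(* A partition of n has at most n parts, each of them at most n; finiteness of
   [intpart n] is transported along this embedding. *)
Definition bseq_of_intpart (n : nat) (p : intpart n) : n.-bseq 'I_n.+1 :=
  insub_bseq n [seq inord k | k <- parts p].

Definition intpart_of_bseq (n : nat) (b : n.-bseq 'I_n.+1) : option (intpart n) :=
  insub [seq val i | i <- b].

Lemma bseq_of_intpartK (n : nat) :
  pcancel (@bseq_of_intpart n) (@intpart_of_bseq n).
Proof.
move=> p; have /and3P[_ p_gt0 /eqP sum_p] := partsP p.
have size_p : size (parts p) <= n by rewrite -[leqRHS]sum_p size_leq_sumn.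
rewrite /intpart_of_bseq /bseq_of_intpart /insub_bseq insubdK; last first.
  by rewrite -topredE /= size_map.
rewrite -map_comp map_id_in ?valK // => k k_in_p /=.
by rewrite inordK // ltnS -[leqRHS]sum_p leq_sumn_part.
Qed.

HB.instance Definition _ (n : nat) : isFinite (intpart n) :=
  PCanIsFinite (@bseq_of_intpartK n).

(* The cell (i, j) lies in row i (from the top) and column j, both counted
   from 0. *)
Definition cells (s : seq nat) : seq (nat * nat) :=
  [seq (i, j) | i <- iota 0 (size s), j <- iota 0 (nth 0 s i)].

Definition arm (s : seq nat) (u : nat * nat) : nat :=
  count (fun v => (v.1 == u.1) && (u.2 < v.2)) (cells s).

Definition leg (s : seq nat) (u : nat * nat) : nat :=
  count (fun v => (v.2 == u.2) && (u.1 < v.1)) (cells s).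

Definition hook_length (s : seq nat) (u : nat * nat) : nat :=
  arm s u + leg s u + 1.

(* Multisets of hook lengths are represented by sequences with repetitions;
   only products over them, which do not depend on the order, are used. *)
Definition hooks (s : seq nat) : seq nat :=
  [seq hook_length s u | u <- cells s].

Definition hooks_trivial_leg (s : seq nat) : seq nat :=
  [seq hook_length s u | u <- cells s & leg s u == 0].

(* Main.v *)
Require Import Defs.
From mathcomp Require Import all_boot all_order perm all_algebra.
From mathcomp Require Import all_reals.
From mathcomp Require Import complex.
From mathcomp Require Import zify ring.

(** Both sides are polynomials in [z], so it is enough to compare them at
    [z = - m^2] for all large integers [m].  There the statement follows from
    an evaluation of the generating series of both sides (for the right-hand
    side this is the Nekrasov-Okounkov formula), for which determinants suffice.

    A partition [lambda] with at most [N] rows is encoded by its beta set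
    [S = {lambda_i + N - 1 - i}], an [N]-set with sum [C(N, 2) + |lambda|].  Let
    [L(t) = (t^(i - j))] be lower triangular, let [U] be the upper triangular
    Toeplitz matrix of [(1 - u)^m], and [A = L(1)^m U].  Up to factors that depend
    on the row or on the column only, the entries of [A] are [1 / (m + i - j)]
    ([toeplitz_entryE]), so the principal minor of [A] on [S] is a Cauchy
    determinant ([minor_cauchy]).  Since the hook lengths of [lambda] complement
    the differences of the elements of [S] in a union of intervals
    ([hooks_pairprod]), this minor is the product of the [(h^2 - m^2) / h^2] over
    all hook lengths [h] of [lambda] ([minor_hooks]).

    Summing over the partitions of [n] amounts to extracting the coefficient of
    [x^(C(N, 2) + n)] in the sum of all principal minors of order [N] of [X A],
    where [X = diag(x^i)].  This sum is a coefficient of [det(1 + y X A)], so it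
    does not change when the factors of [X A] are rotated ([minor_sum_mulC]).
    From [X L(t) = L(x t) X], a factor [L(t)] can be carried to the right end of
    the product, where it arrives as [L(x t)].  Commuting it back through [U] costs
    an update of rank one ([mul_upper_toeplitz_geom]), which multiplies each minor
    whose index set contains [0] by [(1 - x t)^m] ([minor_geom_move]); for [N > n]
    the other index sets do not matter ([small_sum_set]).  Moving all [m] factors
    again and again produces the product of the [(1 - x^k)^(m^2)] and replaces
    [L(1)^m] by matrices that tend to the identity ([minor_sum_rounds]); what
    remains is the generating series of the number of partitions
    ([minor_sum_base], [sum_sets_gen]).

    On the left-hand side, the cells of row [i] with trivial leg have the hook
    lengths [1, ..., lambda_i - lambda_(i+1)], and these row differences are
    arbitrary.  So the generating series is the product over [k] of the series
    [sum_j C(z + j, j) x^(k j)] ([coef_gen_row_diffs]).  By Pascal's rule, lowering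
    [z] by one multiplies it by the product of the [1 - x^k] ([gen_rising_sub1]):
    from [z = 0] to [z = - m^2] the same factor arises. *)

Set Implicit Arguments.
Unset Strict Implicit.
Unset Printing Implicit Defensive.
Import Order.TTheory GRing.Theory Num.Theory.

Local Open Scope ring_scope.
Local Open Scope complex_scope.

(** * Hook lengths along a row *)

Lemma cells_cons a s :
  cells (a :: s) =
    [seq (0%N, j) | j <- iota 0 a] ++ [seq (u.1.+1, u.2) | u <- cells s].
Proof.
rewrite /cells /= -[1%N]addn0 iotaDl; congr (_ ++ _).
by rewrite map_flatten -!map_comp; congr flatten; apply: eq_map => i /=;
  rewrite -map_comp.
Qed.

Lemma leg_cons0 a s j : leg (a :: s) (0%N, j) = count (ltn j) s.
Proof.
rewrite /leg cells_cons count_cat !count_map /=.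
rewrite (eq_count (a2 := pred0)); last by move=> x /=; rewrite andbF.
rewrite count_pred0 add0n; elim: s => //= b s IHs.
rewrite cells_cons count_cat !count_map /= -IHs; congr addn.
rewrite (eq_count (a2 := pred1 j)); last by move=> x /=; rewrite andbT.
by rewrite count_uniq_mem ?iota_uniq // mem_iota.
Qed.

Lemma leg_consS a s i j : leg (a :: s) (i.+1, j) = leg s (i, j).
Proof.
rewrite /leg cells_cons count_cat !count_map /=.
rewrite (eq_count (a2 := pred0)); last by move=> x /=; rewrite andbF.
by rewrite count_pred0.
Qed.

Lemma arm_cons0 a s j : (j < a)%N -> arm (a :: s) (0%N, j) = (a - j.+1)%N.
Proof.
move=> lt_ja; rewrite /arm cells_cons count_cat !count_map /=.
rewrite [X in (_ + X)%N](eq_count (a2 := pred0)) // count_pred0 addn0.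
rewrite -{1}(subnKC lt_ja) iotaD count_cat add0n.
rewrite (eq_in_count (a2 := pred0)); last first.
  by move=> x; rewrite mem_iota /=; lia.
rewrite count_pred0 add0n (eq_in_count (a2 := predT)); last first.
  by move=> x; rewrite mem_iota /=; lia.
by rewrite count_predT size_iota.
Qed.

Lemma arm_consS a s i j : arm (a :: s) (i.+1, j) = arm s (i, j).
Proof.
rewrite /arm cells_cons count_cat !count_map /=.
by rewrite [X in (X + _)%N](eq_count (a2 := pred0)) // count_pred0.
Qed.

Lemma hooks_cons a s :
  hooks (a :: s) =
    [seq (a - j + count (ltn j) s)%N | j <- iota 0 a] ++ hooks s.
Proof.
rewrite /hooks cells_cons map_cat -!map_comp; congr (_ ++ _).
  apply/eq_in_map => j; rewrite mem_iota add0n => /= lt_ja.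
  by rewrite /hook_length leg_cons0 arm_cons0 //; lia.
by apply: eq_map => -[i j]; rewrite /hook_length /= leg_consS arm_consS.
Qed.

Lemma count_ltn_sorted j s :
  sorted geq s -> (count (ltn j) s == 0%N) = (head 0%N s <= j)%N.
Proof.
move=> s_sorted; rewrite -leqn0 leqNgt -has_count; case: s s_sorted => //= b s.
rewrite (path_sortedE (rev_trans leq_trans)) => /andP[/allP le_sb _].
case: ltnP => //= le_bj; apply/hasPn => x /le_sb /=; lia.
Qed.

Lemma hooks_trivial_leg_cons a s : sorted geq (a :: s) ->
  hooks_trivial_leg (a :: s) =
    [seq (a - j)%N | j <- iota (head 0%N s) (a - head 0%N s)]
      ++ hooks_trivial_leg s.
Proof.
move=> as_sorted; have s_sorted := path_sorted as_sorted.
have le_ba : (head 0%N s <= a)%N by case: s as_sorted {s_sorted} => //= b s /andP[].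
rewrite /hooks_trivial_leg cells_cons filter_cat map_cat !filter_map -!map_comp.
congr (_ ++ _).
  have -> : [seq j <- iota 0 a | leg (a :: s) (0%N, j) == 0%N]
              = iota (head 0%N s) (a - head 0%N s).
    rewrite -[in iota 0 a](subnKC le_ba) iotaD filter_cat add0n.
    rewrite (@eq_in_filter _ _ pred0) ?filter_pred0; last first.
      move=> j; rewrite mem_iota /= leg_cons0 count_ltn_sorted //; lia.
    apply/all_filterP/allP => j; rewrite mem_iota /= leg_cons0 count_ltn_sorted //; lia.
  apply/eq_in_map => j; rewrite mem_iota => lt_ja /=.
  rewrite /hook_length leg_cons0 arm_cons0; last by lia.
  have /eqP-> : count (ltn j) s == 0%N by rewrite count_ltn_sorted //; lia.
  lia.
have -> : [seq x <- cells s | leg (a :: s) (x.1.+1, x.2) == 0%N]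
            = [seq u <- cells s | leg s u == 0%N].
  by apply: eq_filter => -[i j] /=; rewrite leg_consS.
by apply: eq_map => -[i j]; rewrite /hook_length /= leg_consS arm_consS.
Qed.

(** The numbers [lambda_i + N - 1 - i], in decreasing order, where [lambda] is
    [s] followed by [e] zero rows and [N = size s + e]. *)
Fixpoint beta (e : nat) (s : seq nat) : seq nat :=
  if s is a :: s' then (a + size s' + e)%N :: beta e s' else rev (iota 0 e).

Fixpoint pairprod (T : Type) (K : pzRingType) (g : T -> T -> K) (t : seq T) : K :=
  if t is a :: t' then (\prod_(b <- t') g a b) * pairprod g t' else 1.

Lemma size_beta e s : size (beta e s) = (size s + e)%N.
Proof. by elim: s => [|a s /= ->] //=; rewrite size_rev size_iota. Qed.

Lemma rev_iotaS e : rev (iota 0 e.+1) = e :: rev (iota 0 e).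
Proof. by rewrite -addn1 iotaD rev_cat. Qed.

Lemma big_iota_rect (K : comPzRingType) (g : nat -> K) a :
  \prod_(j <- iota 0 a) g (a - j)%N = \prod_(1 <= k < a.+1) g k.
Proof.
rewrite -[X in iota 0 X]subn0 -/(index_iota 0 a) big_nat_rev /=.
rewrite big_add1 /=; apply: eq_big_nat => i lt_ia; congr g; lia.
Qed.

Lemma beta_sorted e s : sorted geq s -> sorted gtn (beta e s).
Proof.
elim: s => [_|a s IHs as_sorted] /=.
  rewrite rev_sorted; exact: iota_ltn_sorted.
have /IHs := path_sorted as_sorted.
case: s as_sorted {IHs} => [_|b s /= /andP[le_ba _] ->] /=.
  by case: e => // e; rewrite rev_iotaS /= => ->; rewrite addn0 andbT; lia.
by rewrite andbT; lia.
Qed.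

Lemma beta_head e a s b :
  sorted geq (a :: s) -> b \in beta e s -> (b < a + size s + e)%N.
Proof.
move=> /(@beta_sorted e) /=.
rewrite (path_sortedE (rev_trans ltn_trans)) => /andP[/allP lt_beta _] /lt_beta.
by [].
Qed.

(** The hook lengths of the first row and the differences between the first
    beta number and the others exhaust the interval from [1] to the first beta
    number.  A new part [b] below the first row adds one to the hook lengths in
    the columns before [b] and to the old differences; the hook lengths from
    column [b] on are [1, ..., a - b] before and after, and the new difference
    [a - b + 1] fills the gap. *)
Lemma first_row_beta (K : comPzRingType) (g : nat -> K) e a s :
  sorted geq (a :: s) ->
  \prod_(j <- iota 0 a) g (a - j + count (ltn j) s)%N *
    \prod_(b <- beta e s) g (a + size s + e - b)%N
  = \prod_(1 <= k < (a + size s + e).+1) g k.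
Proof.
elim: s g => [|b s IHs] g as_sorted.
  rewrite /= addn0; under eq_bigr do rewrite addn0.
  rewrite big_iota_rect [RHS](big_cat_nat (n := a.+1)) /=; [|lia..].
  congr (_ * _); rewrite (perm_big _ (introT permPl (perm_rev _))) /=.
  rewrite -[X in iota 0 X]subn0 -/(index_iota 0 e) big_nat_rev /= addnC -addSn.
  rewrite -{1}[a.+1]add0n big_addn (_ : (e.+1 + a - a.+1 = e)%N); last by lia.
  apply: eq_big_nat => i lt_ia; congr g; lia.
have /= /andP[le_ba s_sorted] := as_sorted.
have {}as_sorted : sorted geq (a :: s).
  case: s s_sorted {IHs as_sorted} => //= c s /andP[le_cb ->]; rewrite andbT.
  exact: leq_trans le_cb le_ba.
(* In the induction hypothesis all numbers are shifted by one. *)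
have := IHs (g \o succn) as_sorted; rewrite /= => {}IHs.
rewrite /= big_cons.
have -> : (a + (size s).+1 + e - (b + size s + e) = (a - b).+1)%N by lia.
rewrite big_ltn; last by lia.
rewrite addnS addSn big_add1 /= -IHs.
have -> : \prod_(j <- beta e s) g (a + size s + e - j).+1
        = \prod_(j <- beta e s) g ((a + size s + e).+1 - j)%N.
  apply: eq_big_seq => j j_in; congr g; rewrite subSn //.
  have : (j < b + size s + e)%N.
    apply: beta_head j_in; case: s s_sorted {IHs as_sorted} => //.
  lia.
rewrite !mulrA; congr (_ * _); rewrite mulrC.
have split_iota (F : nat -> K) : \prod_(j <- iota 0 a) F j
    = \prod_(j <- iota 0 b) F j * \prod_(j <- iota 0 (a - b)) F (b + j)%N.
  rewrite -{1}(subnKC le_ba) iotaD big_cat add0n; congr (_ * _).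
  by rewrite -[X in iota X (a - b)]addn0 iotaDl big_map.
rewrite !split_iota.
have -> : \prod_(j <- iota 0 b) g (a - j + ((j < b) + count (ltn j) s))%N
        = \prod_(j <- iota 0 b) g (a - j + count (ltn j) s).+1.
  apply: eq_big_seq => j; rewrite mem_iota => /= lt_jb; congr g; lia.
have count0 j : count (ltn (b + j)%N) s = 0%N.
  apply/eqP; rewrite count_ltn_sorted ?(path_sorted s_sorted) //.
  by case: s s_sorted {as_sorted IHs} => //= c s /andP[/= le_cb _]; lia.
have -> : \prod_(j <- iota 0 (a - b))
            g (a - (b + j) + ((b + j < b) + count (ltn (b + j)) s))%N
        = \prod_(j <- iota 0 (a - b)) g (a - b - j)%N.
  apply: eq_bigr => j _; rewrite count0; congr g; lia.
have -> : \prod_(j <- iota 0 (a - b)) g (a - (b + j) + count (ltn (b + j)) s).+1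
        = \prod_(j <- iota 0 (a - b)) (g \o succn) (a - b - j)%N.
  apply: eq_bigr => j _; rewrite count0 /=; congr g; lia.
rewrite mulrCA [RHS]mulrCA; congr (_ * _); rewrite !big_iota_rect.
by rewrite mulrC -big_nat_recr //= big_ltn // big_add1.
Qed.

(** Removing the first row removes the first beta number and does not change
    the other hook lengths, so this is [first_row_beta] for each row. *)
Lemma hooks_pairprod (K : comPzRingType) (g : nat -> K) e s : sorted geq s ->
  \prod_(h <- hooks s) g h * pairprod (fun a b => g (a - b)%N) (beta e s)
  = \prod_(a <- beta e s) \prod_(1 <= k < a.+1) g k.
Proof.
elim: s => [_|a s IHs as_sorted] /=.
  rewrite big_nil mul1r; elim: e => [|e IHe]; first by rewrite /= big_nil.
  rewrite rev_iotaS /= big_cons IHe; congr (_ * _).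
  rewrite (perm_big _ (introT permPl (perm_rev _))) /=.
  exact: big_iota_rect.
rewrite hooks_cons big_cat big_cons big_map /= -IHs ?(path_sorted as_sorted) //.
by rewrite -first_row_beta // mulrACA.
Qed.

(** * Beta sets *)

Lemma big_bij (V : nmodType) (I J : finType) (h : I -> J) (P : pred J)
    (F : J -> V) :
  injective h -> (forall i, P (h i)) -> (forall j, P j -> exists i, h i = j) ->
  \sum_(j | P j) F j = \sum_i F (h i).
Proof.
move=> h_inj Ph h_surj.
rewrite -(big_imset F (h := h) (A := predT)) => [|x y _ _ /h_inj //].
apply: eq_bigl => j; apply/idP/imsetP => [/h_surj[i <-]|[i _ ->] //].
by exists i.
Qed.

Lemma beta_lt e s b : b \in beta e s -> (b < sumn s + size s + e)%N.
Proof.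
elim: s => [|a s IHs] /=; first by rewrite mem_rev mem_iota.
by rewrite inE => /orP[/eqP->|/IHs]; lia.
Qed.

Lemma sumn_beta e s : sumn (beta e s) = (sumn s + 'C(size s + e, 2))%N.
Proof.
elim: s => [|a s IHs] /=; last by rewrite IHs addSn binS bin1; lia.
by elim: e => // e IHe; rewrite rev_iotaS /= IHe !add0n binS bin1 addnC.
Qed.

Lemma beta_surj t : sorted gtn t ->
  exists s e, [/\ sorted geq s, all (leq 1) s & beta e s = t].
Proof.
elim: t => [_|a t IHt at_sorted]; first by exists [::], 0%N.
have [s [e [s_sorted s_gt0 def_t]]] := IHt (path_sorted at_sorted).
have lt_ta : (head 0%N t < a)%N || (t == [::]).
  by case: t at_sorted {IHt def_t} => [|b t] /=; [rewrite orbT | case/andP => ->].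
have [a_eq|a_neq] := eqVneq a (size s + e)%N.
  case: s => [|b s] in s_sorted s_gt0 def_t a_eq *.
    exists [::], e.+1; split=> //; rewrite /= rev_iotaS -def_t a_eq //.
  move: lt_ta s_gt0; rewrite -def_t a_eq /= orbF => lt_ta /andP[]; lia.
exists ((a - (size s + e))%N :: s), e; rewrite /= def_t.
case: s => [|b s] /= in s_sorted s_gt0 def_t a_neq *.
  have ? : (e < a)%N.
    case: e => [|e] in a_neq def_t *; first by rewrite lt0n; exact: a_neq.
    by move: lt_ta; rewrite -def_t rev_iotaS /= orbF; lia.
  by split=> //; [rewrite andbT; lia | congr cons; lia].
move: lt_ta; rewrite -def_t /= orbF => lt_ta; case/andP: (s_gt0) => b_gt0 _.
split; [rewrite s_sorted andbT /=; lia | rewrite s_gt0 andbT; lia | congr cons; lia].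
Qed.

Lemma beta_inj e e' s s' : all (leq 1) s -> all (leq 1) s' ->
  beta e s = beta e' s' -> s = s'.
Proof.
elim: s s' => [|a s IHs] [|a' s'] //=.
- move=> _ /andP[a'_gt0 _]; case: e => // e; rewrite rev_iotaS => -[eq_e eq_s].
  by have := congr1 size eq_s; rewrite size_beta size_rev size_iota; lia.
- move=> /andP[a_gt0 _] _; case: e' {IHs} => // e'; rewrite rev_iotaS => -[eq_e eq_s].
  by have := congr1 size eq_s; rewrite size_beta size_rev size_iota; lia.
move=> /andP[a_gt0 s_gt0] /andP[a'_gt0 s'_gt0] [eq_a eq_s].
have := congr1 size eq_s; rewrite !size_beta => eq_size.
by rewrite (IHs _ s_gt0 s'_gt0 eq_s); congr cons; lia.
Qed.

Definition beta_ord M N (s : seq nat) : seq 'I_M.+1 :=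
  [seq inord i | i <- beta (N - size s) s].

Lemma gtn_sorted_eq (s t : seq nat) :
  sorted gtn s -> sorted gtn t -> s =i t -> s = t.
Proof. apply: irr_sorted_eq; [exact: rev_trans ltn_trans | exact: ltnn]. Qed.

Lemma intpart_facts d (p : intpart d) :
  [/\ sorted geq p, all (leq 1) p, sumn p = d & (size p <= d)%N].
Proof.
have /and3P[p_sorted p_gt0 /eqP sum_p] := partsP p; split=> //.
by rewrite -[leqRHS]sum_p size_leq_sumn.
Qed.

Lemma val_beta_ord M N d (p : intpart d) : (d <= N)%N -> (N + d <= M.+1)%N ->
  [seq val i | i <- beta_ord M N p] = beta (N - size p) p.
Proof.
move=> le_dN le_NM; have [_ _ sum_p size_p] := intpart_facts p.
rewrite -map_comp map_id_in // => i /beta_lt lt_i /=; rewrite inordK //.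
lia.
Qed.

Lemma uniq_beta_ord M N d (p : intpart d) : (d <= N)%N -> (N + d <= M.+1)%N ->
  uniq (beta_ord M N p).
Proof.
move=> le_dN le_NM; apply: (@map_uniq _ _ val); rewrite val_beta_ord //.
have [p_sorted _ _ _] := intpart_facts p.
apply: sorted_uniq (beta_sorted _ p_sorted); [exact: rev_trans ltn_trans | exact: ltnn].
Qed.

(** A decreasing sequence of naturals ends with a maximal run [e - 1, ..., 0],
    which is the padding; the terms before it give the nonzero rows. *)
Lemma set_betaP M (S : {set 'I_M}) :
  exists s e, [/\ sorted geq s, all (leq 1) s, (size s + e)%N = #|S|,
    forall i : 'I_M, (i \in S) = (val i \in beta e s)
    & (\sum_(i in S) i = sumn s + 'C(#|S|, 2))%N].
Proof.
set t := sort geq [seq val i | i <- enum S].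
have uniq_t : uniq t by rewrite sort_uniq map_inj_uniq ?enum_uniq //; apply: val_inj.
have t_sorted : sorted gtn t.
  rewrite gtn_sorted_uniq_geq uniq_t /=; apply: sort_sorted => x y; exact: leq_total.
have [s [e [s_sorted s_gt0 def_t]]] := beta_surj t_sorted.
have size_t : (size s + e = #|S|)%N.
  by rewrite -size_beta def_t size_sort size_map -cardE.
exists s, e; split=> // [i|].
  by rewrite def_t mem_sort (mem_map val_inj) mem_enum.
rewrite -size_t -sumn_beta def_t.
by rewrite sumnE (perm_big _ (introT permPl (perm_sort _ _))) big_map big_enum.
Qed.

(** The bound [d <= N] leaves room for all rows of a partition of [d], and
    [N + d <= M.+1] for its largest beta number. *)
Lemma sum_intpart_sets (V : nmodType) M N d (F : {set 'I_M.+1} -> V) :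
  (d <= N)%N -> (N + d <= M.+1)%N ->
  \sum_(S : {set 'I_M.+1} | (#|S| == N)
        && ((\sum_(i in S) i)%N == 'C(N, 2) + d)%N) F S
  = \sum_(p : intpart d) F [set x in beta_ord M N p].
Proof.
move=> le_dN le_NM.
apply: big_bij (fun p : intpart d => [set x in beta_ord M N p]) _ _ _ _ _.
- move=> p q /setP eq_pq; apply: val_inj => /=.
  have [p_sorted p_gt0 _ _] := intpart_facts p.
  have [q_sorted q_gt0 _ _] := intpart_facts q.
  apply: (beta_inj (e := N - size p) (e' := N - size q)) => //.
  apply: gtn_sorted_eq; rewrite ?beta_sorted // => x.
  rewrite -!(val_beta_ord _ le_dN le_NM) //.
  by apply/mapP/mapP => -[i i_in ->]; exists i => //;
    move: (eq_pq i); rewrite !inE i_in; [move=> <- | move=> ->].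
- move=> p; have uniq_p := uniq_beta_ord p le_dN le_NM.
  have [_ _ sum_p size_p] := intpart_facts p.
  rewrite cardsE (card_uniqP uniq_p) size_map size_beta subnKC ?(leq_trans size_p) //.
  rewrite eqxx (eq_bigl (mem (beta_ord M N p))) => [|i]; last by rewrite inE.
  rewrite -big_uniq //= -(big_map val predT id) val_beta_ord // -sumnE.
  by rewrite sumn_beta sum_p subnKC ?(leq_trans size_p) // addnC.
move=> S /andP[/eqP card_S /eqP sum_S].
have [s [e [s_sorted s_gt0 size_t mem_S sum_s]]] := set_betaP S.
rewrite card_S sum_S in size_t sum_s; have {}sum_s : sumn s = d by lia.
have s_part : is_partition d s by rewrite /is_partition s_sorted s_gt0 sum_s /=.
exists (IntPart s_part); apply/setP => i.
rewrite mem_S inE -(mem_map val_inj) val_beta_ord //=.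
by rewrite -size_t addKn.
Qed.

(** * Row differences and the cells with trivial leg *)

Definition row_diff (s : seq nat) i := (nth 0 s i - nth 0 s i.+1)%N.

Lemma nth_sorted_geq s i : sorted geq s -> (nth 0 s i.+1 <= nth 0 s i)%N.
Proof.
elim: s i => [|a s IHs] [|i] //= as_sorted; last exact: IHs (path_sorted as_sorted).
by case: s as_sorted {IHs} => //= b s /andP[].
Qed.

(** The cells with trivial leg in row [i] are the last
    [lambda_i - lambda_(i+1)] ones. *)
Lemma big_hooks_trivial_leg (K : comPzRingType) (g : nat -> K) k s :
  sorted geq s -> (size s <= k)%N ->
  \prod_(h <- hooks_trivial_leg s) g h
  = \prod_(i < k) \prod_(1 <= j < (row_diff s i).+1) g j.
Proof.
elim: s k => [|a s IHs] k s_sorted size_s.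
  by rewrite big_nil big1 // => i _; rewrite /row_diff !nth_nil big_geq.
case: k => // k in size_s *.
rewrite hooks_trivial_leg_cons // big_cat big_ord_recl /=.
rewrite -IHs ?(path_sorted s_sorted) //; congr (_ * _).
rewrite big_map /row_diff /= nth0 -big_iota_rect -[X in iota X _]addn0 iotaDl.
rewrite big_map; apply: eq_bigr => j _; congr g; lia.
Qed.

Lemma sum_tails (f : nat -> nat) k :
  (\sum_(0 <= i < k) \sum_(i <= j < k) f j = \sum_(0 <= j < k) j.+1 * f j)%N.
Proof.
elim: k => [|k IHk]; first by rewrite !big_nil.
rewrite !big_nat_recr //= [X in (_ + (X + _))%N]big_geq // add0n -IHk mulSn.
rewrite [(f k + _)%N]addnC addnA; congr addn.
have -> : (k * f k = \sum_(0 <= i < k) f k)%N by rewrite sum_nat_const_nat subn0.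
rewrite -big_split /=.
by apply: eq_big_nat => i /andP[_ lt_ik]; rewrite big_nat_recr // ltnW.
Qed.

Lemma nth_row_diff s k i : sorted geq s -> (size s <= k)%N -> (i <= k)%N ->
  nth 0%N s i = (\sum_(i <= j < k) row_diff s j)%N.
Proof.
move=> s_sorted size_s; move: {2}(k - i)%N (erefl (k - i)%N) => m.
elim: m i => [|m IHm] i def_m le_ik.
  by rewrite big_geq ?nth_default //; lia.
rewrite big_ltn; last by lia.
by rewrite -IHm; [rewrite subnK ?nth_sorted_geq | lia | lia].
Qed.

Lemma sumn_nth s k : (size s <= k)%N -> sumn s = (\sum_(0 <= i < k) nth 0 s i)%N.
Proof.
move=> size_s; rewrite sumnE (big_nth 0%N) (big_cat_nat (n := size s) (p := k)) //=.
rewrite -[LHS]addn0; congr addn; apply/esym; rewrite big_nat_cond big1 // => i.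
by case/andP => /andP[le_i _] _; rewrite nth_default.
Qed.

Lemma sumn_row_diff s k : sorted geq s -> (size s <= k)%N ->
  sumn s = (\sum_(0 <= j < k) j.+1 * row_diff s j)%N.
Proof.
move=> s_sorted size_s; rewrite -sum_tails (sumn_nth size_s).
by apply: eq_big_nat => i /andP[_ lt_ik]; rewrite (nth_row_diff (k := k)) // ltnW.
Qed.

Lemma nth_pos_inj s t : all (leq 1) s -> all (leq 1) t ->
  (forall i, nth 0%N s i = nth 0%N t i) -> s = t.
Proof.
elim: s t => [|a s IHs] [|b t] //=.
- by move=> _ /andP[b_gt0 _] /(_ 0%N) /= eq_b; rewrite -eq_b in b_gt0.
- by move=> /andP[a_gt0 _] _ /(_ 0%N) /= eq_a; rewrite eq_a in a_gt0.
move=> /andP[_ s_gt0] /andP[_ t_gt0] eq_st.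
by rewrite (eq_st 0%N : a = b) (IHs t) // => i; apply: (eq_st i.+1).
Qed.

Lemma nth_filter_pos s i :
  sorted geq s -> nth 0%N [seq a <- s | (1 <= a)%N] i = nth 0%N s i.
Proof.
elim: s i => //= a s IHs i as_sorted; have s_sorted := path_sorted as_sorted.
case: ltnP => [_|]; first by case: i => //= i; apply: IHs.
rewrite leqn0 => /eqP a0; move: as_sorted; rewrite a0.
rewrite (path_sortedE (rev_trans leq_trans)) => /andP[/allP s0 _].
rewrite IHs //; have nth_s0 j : nth 0%N s j = 0%N.
  have [lt_j|?] := ltnP j (size s); last exact: nth_default.
  by have := s0 _ (mem_nth 0%N lt_j) => /=; lia.
by case: i => [|i] /=; rewrite nth_s0.
Qed.

Lemma sumn_filter_pos s : sumn [seq a <- s | (1 <= a)%N] = sumn s.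
Proof. by elim: s => // -[|a] s //= ->. Qed.

Lemma row_diff_leq d (p : intpart d) i : (row_diff p i <= d)%N.
Proof.
have [_ _ sum_p _] := intpart_facts p; apply: leq_trans (leq_subr _ _) _.
have [lt_i|ge_i] := ltnP i (size p); last by rewrite nth_default.
by rewrite -[leqRHS]sum_p leq_sumn_part // mem_nth.
Qed.

(** The row differences are the multiplicities of the parts of the conjugate
    partition, hence arbitrary up to the size condition. *)
Lemma sum_intpart_row_diffs (V : nmodType) n k d (F : {ffun 'I_k -> 'I_n.+1} -> V) :
  (d <= n)%N -> (d <= k)%N ->
  \sum_(q : {ffun 'I_k -> 'I_n.+1} | (\sum_(i < k) i.+1 * q i)%N == d) F q
  = \sum_(p : intpart d) F [ffun i : 'I_k => inord (row_diff p i)].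
Proof.
move=> le_dn le_dk.
have inordE (p : intpart d) i : @inord n (row_diff p i) = row_diff p i :> nat.
  by rewrite inordK // ltnS (leq_trans (row_diff_leq _ _)).
apply: big_bij (fun p : intpart d => [ffun i : 'I_k => inord (row_diff p i)]) _ _ _ _ _.
- move=> p q /ffunP eq_pq; apply: val_inj => /=.
  have [p_sorted p_gt0 _ /leq_trans/(_ le_dk) size_p] := intpart_facts p.
  have [q_sorted q_gt0 _ /leq_trans/(_ le_dk) size_q] := intpart_facts q.
  apply: nth_pos_inj => // i.
  have [lt_ki|le_ik] := ltnP k i; first by rewrite !nth_default //; lia.
  rewrite !(nth_row_diff (k := k)) //; apply: eq_big_nat => j /andP[_ lt_jk].
  have /(congr1 val) := eq_pq (Ordinal lt_jk); rewrite !ffunE /=.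
  by rewrite !inordE.
- move=> p; have [p_sorted p_gt0 sum_p size_p] := intpart_facts p.
  rewrite -[X in _ == X]sum_p (sumn_row_diff (k := k)) ?(leq_trans size_p) //.
  by rewrite big_mkord; apply/eqP/eq_bigr => i _; rewrite ffunE inordE.
move=> q /eqP sum_q; pose f j := if insub j is Some i then q i : nat else 0%N.
have fE (i : 'I_k) : f i = q i by rewrite /f valK.
pose t := mkseq (fun i => \sum_(i <= j < k) f j)%N k.
have t_nth i : nth 0%N t i = (\sum_(i <= j < k) f j)%N.
  have [lt_ik|le_ki] := ltnP i k; first by rewrite nth_mkseq.
  by rewrite nth_default ?size_mkseq // big_geq.
have t_sorted : sorted geq t.
  apply/(sortedP 0%N) => i _; rewrite !t_nth /=.
  have [lt_ik|le_ki] := ltnP i k; first by rewrite [leqRHS]big_ltn // leq_addl.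
  by rewrite !big_geq // ltnW.
pose s := [seq a <- t | (1 <= a)%N].
have s_sorted : sorted geq s.
  by apply: sorted_filter t_sorted; apply: rev_trans leq_trans.
have sum_s : sumn s = d.
  rewrite sumn_filter_pos (@sumn_nth _ k) ?size_mkseq //.
  under eq_bigr do rewrite t_nth.
  rewrite sum_tails big_mkord -sum_q; apply: eq_bigr => i _; by rewrite fE.
have s_part : is_partition d s.
  rewrite /is_partition s_sorted sum_s eqxx andbT /=.
  by apply/allP => a; rewrite mem_filter => /andP[].
exists (IntPart s_part); apply/ffunP => i; apply: val_inj; rewrite ffunE.
rewrite [LHS]inordE /row_diff /= !nth_filter_pos // !t_nth.
by rewrite [in X in (X - _)%N]big_ltn // addnK fE.
Qed.

Lemma coef_gen_row_diffs (K : comNzRingType) n k d (f : nat -> K) :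
  (d <= n)%N -> (d <= k)%N ->
  (\prod_(i < k) \sum_(j < n.+1) f j *: 'X^(i.+1 * j))`_d
  = \sum_(p : intpart d) \prod_(i < k) f (row_diff p i).
Proof.
move=> le_dn le_dk.
rewrite bigA_distr_bigA /= coef_sum.
rewrite (eq_bigr (fun q : {ffun 'I_k -> 'I_n.+1} =>
  if (\sum_(i < k) i.+1 * q i)%N == d then \prod_(i < k) f (q i) else 0)).
  rewrite -big_mkcond sum_intpart_row_diffs //; apply: eq_bigr => p _.
  apply: eq_bigr => i _; rewrite ffunE inordK //.
  by rewrite ltnS (leq_trans (row_diff_leq _ _)).
move=> q _; rewrite scaler_prod -expr_sum coefZ coefXn eq_sym.
by case: eqP; rewrite ?mulr1 ?mulr0.
Qed.

(** * Principal minors *)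

(** With the rows outside [S] taken from the identity, the determinant is the
    principal minor on [S], without any reindexing of [S]. *)
Definition rows_in (K : pzRingType) n (S : {set 'I_n}) (A : 'M[K]_n) : 'M[K]_n :=
  \matrix_(i, j) if i \in S then A i j else (i == j)%:R.

Definition principal_minor (K : comPzRingType) n (S : {set 'I_n}) (A : 'M[K]_n) : K :=
  \det (rows_in S A).

Definition minor_sum (K : comPzRingType) n k (A : 'M[K]_n) : K :=
  \sum_(S : {set 'I_n} | #|S| == k) principal_minor S A.

Lemma minor_eq (K : comPzRingType) n (S : {set 'I_n}) (A B : 'M[K]_n) :
  (forall i j, i \in S -> A i j = B i j) -> principal_minor S A = principal_minor S B.
Proof.
move=> eqAB; congr (\det _); apply/matrixP => i j; rewrite !mxE.
by case: ifP => // /eqAB.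
Qed.

(** Row [i] of [1 + y A] is the sum of row [i] of the identity and of [y] times
    row [i] of [A]; the determinant is expanded along these choices. *)
Lemma det_1addX (K : comNzRingType) n (A : 'M[K]_n) :
  \det (1%:M + 'X *: map_mx polyC A) = \sum_S (principal_minor S A)%:P * 'X^#|S|.
Proof.
transitivity (\sum_(S : {set 'I_n}) \sum_(s : 'S_n) (-1) ^+ s *
   ((\prod_i rows_in S A i (s i))%:P * 'X^#|S|)).
  rewrite exchange_big; apply: eq_bigr => s _; rewrite -mulr_sumr; congr (_ * _).
  under eq_bigr do rewrite !mxE addrC.
  rewrite bigA_distr; apply: eq_big => [S|S _]; first by rewrite inE.
  rewrite rmorph_prod /= -prodr_const [X in _ * X]big_mkcond -big_split /=.
  apply: eq_bigr => i _; rewrite mxE; case: ifP => _; first by rewrite mulrC.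
  by rewrite mulr1 polyC_natr.
apply: eq_bigr => S _; rewrite /principal_minor /determinant rmorph_sum mulr_suml /=.
by apply: eq_bigr => s _; rewrite rmorphM rmorphXn rmorphN1 mulrA.
Qed.

Lemma coef_det_1addX (K : comNzRingType) n k (A : 'M[K]_n) :
  (\det (1%:M + 'X *: map_mx polyC A))`_k = minor_sum k A.
Proof.
rewrite det_1addX coef_sum /minor_sum [RHS]big_mkcond; apply: eq_bigr => S _.
by rewrite coefCM coefXn eq_sym; case: eqP; rewrite ?mulr1 ?mulr0.
Qed.

(** The sums of principal minors are the coefficients of [det(1 + y A)], which
    is invariant under conjugation. *)
Lemma minor_sum_mulC (K : comUnitRingType) n k (A C : 'M[K]_n) :
  C \in unitmx -> minor_sum k (C *m A) = minor_sum k (A *m C).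
Proof.
move=> C_unit; rewrite -!coef_det_1addX; congr (_ : {poly K})`_k.
have CVC : map_mx polyC (invmx C) *m map_mx polyC C = 1%:M.
  by rewrite -map_mxM mulVmx // map_mx1.
rewrite !map_mxM /=; set A' := map_mx _ A; set C' := map_mx _ C in CVC *.
set D' := map_mx _ _ in CVC.
have -> : 1%:M + 'X *: (A' *m C') = D' *m (1%:M + 'X *: (C' *m A')) *m C'.
  rewrite mulmxDr mulmxDl mulmx1 CVC -scalemxAr -scalemxAl; congr (_ + _ *: _).
  by rewrite !mulmxA CVC mul1mx.
by rewrite !det_mulmx mulrAC -det_mulmx CVC det1 mul1r.
Qed.

Lemma minor_diag (K : comPzRingType) n (S : {set 'I_n}) (d : 'rV[K]_n) A :
  principal_minor S (diag_mx d *m A) = (\prod_(i in S) d 0 i) * principal_minor S A.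
Proof.
pose dS : 'rV[K]_n := \row_i if i \in S then d 0 i else 1.
have -> : \prod_(i in S) d 0 i = \det (diag_mx dS).
  by rewrite det_diag big_mkcond; apply: eq_bigr => i _; rewrite mxE.
rewrite -det_mulmx; congr (\det _); rewrite !mul_diag_mx.
by apply/matrixP => i j; rewrite !mxE; case: ifP => // _; rewrite mul1r.
Qed.

(** The matrix [1 + e_c r], a perturbation of the identity in row [c] only. *)
Definition row_update (K : pzRingType) n (c : 'I_n) (r : 'I_n -> K) : 'M[K]_n :=
  \matrix_(i, j) ((i == j)%:R + (i == c)%:R * r j).

(** The cofactors along row [c] do not depend on [r]. *)
Lemma det_row_update (K : comPzRingType) n (c : 'I_n) (r : 'I_n -> K) :
  \det (row_update c r) = 1 + r c.
Proof.
have cofactor1 j : cofactor (row_update c r) c j = (c == j)%:R.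
  transitivity (cofactor (1%:M : 'M[K]_n) c j).
    congr (_ * \det _); apply/matrixP => i k; rewrite !mxE.
    by rewrite [_ == c]eq_sym (negPf (neq_lift _ _)) mul0r addr0.
  have := mul_adj_mx (1%:M : 'M[K]_n); rewrite mulmx1 det1 => /matrixP/(_ j c).
  by rewrite !mxE eq_sym => ->.
rewrite (expand_det_row _ c) (bigD1 c) //= big1 => [|j /negPf ne_jc].
  by rewrite cofactor1 !mxE eqxx mulr1 mul1r addr0.
by rewrite cofactor1 eq_sym ne_jc mulr0.
Qed.

Lemma mul_mx_row_update (K : pzRingType) n (A : 'M[K]_n) c r i j :
  (A *m row_update c r) i j = A i j + A i c * r j.
Proof.
rewrite mxE; under eq_bigr do rewrite mxE mulrDr mulrA.
rewrite big_split /=; congr (_ + _).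
  rewrite (bigD1 j) //= eqxx mulr1 big1 ?addr0 // => k /negPf->.
  by rewrite mulr0.
rewrite (bigD1 c) //= eqxx mulr1 big1 ?addr0 // => k /negPf->.
by rewrite mulr0 mul0r.
Qed.

Lemma mul_col_update_mx (K : comPzRingType) n (A : 'M[K]_n) c r i j :
  ((row_update c r)^T *m A) i j = A i j + r i * A c j.
Proof.
rewrite -[A in LHS]trmxK -trmx_mul mxE mul_mx_row_update !mxE.
by rewrite [_ * r i]mulrC.
Qed.

(** Since [c] is in [S], right multiplication by [row_update c r] fixes the
    identity rows outside [S]. *)
Lemma minor_mul_row_update (K : comPzRingType) n (S : {set 'I_n})
    (A : 'M[K]_n) c (r : 'I_n -> K) :
  c \in S -> principal_minor S (A *m row_update c r) = (1 + r c) * principal_minor S A.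
Proof.
move=> cS; rewrite -det_row_update mulrC -det_mulmx; congr (\det _).
apply/matrixP => i j; rewrite [RHS]mul_mx_row_update ![rows_in _ _ _ _]mxE.
case: ifP => iS; first by rewrite mul_mx_row_update.
by rewrite (_ : i == c = false) ?mul0r ?addr0 //; apply: contraFF iS => /eqP->.
Qed.

(** One step of Gaussian elimination, with pivot [A c c]. *)
Lemma minor_pivot (K : fieldType) n (S : {set 'I_n}) (c : 'I_n) (A : 'M[K]_n) :
  c \notin S -> A c c != 0 ->
  principal_minor (c |: S) A
  = A c c * principal_minor S (\matrix_(i, j) (A i j - A i c * A c j / A c c)).
Proof.
move=> cS Acc; set A' := \matrix_(_, _) _.
(* Left multiplication by the transpose of [row_update c v] clears column [c],
   right multiplication by [row_update c r] clears row [c]. *)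
pose v i := if i \in S then A i c / A c c else 0.
pose r j := A c j - (c == j)%:R.
have -> : A c c = 1 + r c by rewrite /r eqxx addrC subrK.
have -> : 1 + r c = (1 + v c) * (1 + r c) by rewrite /v (negPf cS) addr0 mul1r.
rewrite -!det_row_update -[\det (row_update c v)]det_tr mulrAC -!det_mulmx.
congr (\det _); apply/matrixP => i j.
rewrite mul_mx_row_update !mul_col_update_mx !mxE (negPf cS) /v /r !in_setU1.
have [->|ne_ic] /= := eqVneq i c.
  by rewrite (negPf cS) eqxx; ring.
case: ifP => iS; last by ring.
rewrite eqxx; move: (_%:R) => delta.
by rewrite mulr1; field.
Qed.

Lemma minor_set0 (K : comPzRingType) n (A : 'M[K]_n) : principal_minor set0 A = 1.
Proof.
rewrite -[RHS](det1 _ n); congr (\det _); apply/matrixP => i j.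
by rewrite !mxE inE.
Qed.

(** Eliminating an index [c] leaves a matrix of the same shape, in which [p i]
    and [q j] are multiplied by [(x i - x c) / (x i - y c)] and
    [(y c - y j) / (x c - y j)]. *)
Lemma minor_cauchy (K : fieldType) n (x y p q : 'I_n -> K) (t : seq 'I_n)
    (A : 'M[K]_n) :
  uniq t -> {in t &, forall i j, x i - y j != 0} ->
  {in t, forall i, p i * q i != 0} -> {in t &, injective x} -> {in t &, injective y} ->
  {in t &, forall i j, A i j = p i * q j / (x i - y j)} ->
  principal_minor [set i in t] A
  = \prod_(i <- t) A i i * pairprod (fun i j => (x i - x j) * (y j - y i)
                                        / ((x i - y j) * (x j - y i))) t.
Proof.
elim: t p q A => [|c t IHt] p q A /=.
  by rewrite big_nil mulr1 => *; apply: minor_set0.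
case/andP => ct uniq_t xy pq x_inj y_inj AE; have ht i : i \in t -> i \in c :: t.
  by rewrite inE => ->; rewrite orbT.
have ch : c \in c :: t by rewrite inE eqxx.
have Acc : A c c != 0.
  by rewrite AE // mulf_neq0 ?invr_eq0 ?xy // pq.
have -> : [set i in c :: t] = c |: [set i in t].
  by apply/setP => i; rewrite !inE.
rewrite minor_pivot ?inE // big_cons -!mulrA; congr (_ * _).
set A' := \matrix_(_, _) _.
pose p' i := p i * ((x i - x c) / (x i - y c)).
pose q' j := q j * ((y c - y j) / (x c - y j)).
have A'E : {in t &, forall i j, A' i j = p' i * q' j / (x i - y j)}.
  move=> i j it jt; rewrite mxE !AE ?ch ?ht // /p' /q'.
  have := pq c ch; rewrite mulf_eq0 negb_or => /andP[pc qc].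
  by field; rewrite !xy ?ch ?ht // qc pc.
have ne_ct i : i \in t -> (x i - x c) * (y c - y i) != 0.
  move=> it; rewrite mulf_neq0 // subr_eq0; apply: contraNneq ct.
    by move=> /(x_inj _ _ (ht i it) ch) <-.
  by move=> /(y_inj _ _ ch (ht i it)) ->.
rewrite (IHt p' q') //; first last.
- by move=> i j it jt; apply: y_inj; apply: ht.
- by move=> i j it jt; apply: x_inj; apply: ht.
- move=> i it; rewrite /p' /q' mulrACA mulf_neq0 ?pq ?ht // mulrACA.
  by rewrite mulf_neq0 ?ne_ct // -invfM invr_eq0 mulf_neq0 ?xy ?ch ?ht.
- by move=> i j it jt; apply: xy; apply: ht.
rewrite mulrA; congr (_ * _); rewrite -big_split; apply: eq_big_seq => i it /=.
rewrite A'E // AE ?ch ?ht // /p' /q'; field; rewrite !xy ?ch ?ht //.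
Qed.

(** * Toeplitz matrices *)

Definition lower_toeplitz (K : pzRingType) n (f : nat -> K) : 'M[K]_n :=
  \matrix_(i, j) if (j <= i)%N then f (i - j)%N else 0.

Definition conv (K : pzRingType) (f g : nat -> K) k : K :=
  \sum_(c < k.+1) f c * g (k - c)%N.

Lemma convC (K : comPzRingType) (f g : nat -> K) : conv f g =1 conv g f.
Proof.
move=> k; rewrite /conv (reindex_inj rev_ord_inj) /=; apply: eq_bigr => i _.
have le_ik : (i <= k)%N := ltn_ord i.
by rewrite subSS (subKn le_ik) [LHS]mulrC.
Qed.

Lemma mul_lower_toeplitz (K : pzRingType) n (f g : nat -> K) :
  lower_toeplitz n f *m lower_toeplitz n g = lower_toeplitz n (conv f g).
Proof.
apply/matrixP => i j; rewrite !mxE.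
pose F c := (if (c <= i)%N then f (i - c)%N else 0)
              * (if (j <= c)%N then g (c - j)%N else 0).
transitivity (\sum_(0 <= c < n) F c).
  by rewrite big_mkord; apply: eq_bigr => c _; rewrite !mxE.
case: leqP => [le_ji|lt_ij]; last first.
  rewrite big1 // => c _; rewrite /F.
  case: (leqP c i) => [le_ci|_]; last by rewrite mul0r.
  by rewrite leqNgt (leq_ltn_trans le_ci lt_ij) mulr0.
rewrite (big_cat_nat (n := j)) //=; last by have := ltn_ord j; lia.
rewrite big_nat_cond big1 ?add0r; last first.
  by move=> c /andP[/andP[_ lt_cj] _]; rewrite /F [(j <= c)%N]leqNgt lt_cj mulr0.
rewrite (big_cat_nat (n := i.+1)) //=; last by rewrite ltnW.
rewrite [X in _ + X]big_nat_cond [X in _ + X]big1 ?addr0; last first.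
  by move=> c /andP[/andP[lt_ic _] _]; rewrite /F [(c <= i)%N]leqNgt lt_ic mul0r.
rewrite -{1}[j : nat]add0n big_addn big_nat_rev /= add0n subSn // big_mkord.
apply: eq_bigr => c _; have := ltn_ord c; rewrite /F => lt_c.
rewrite !ifT; [congr (f _ * g _); lia | lia | lia].
Qed.

Lemma lower_toeplitz1 (K : pzRingType) n :
  1%:M = lower_toeplitz n (fun k => (k == 0%N)%:R : K).
Proof.
apply/matrixP => i j; rewrite !mxE -val_eqE /=; case: leqP => [le_ji|lt_ij].
  by rewrite subn_eq0 eqn_leq le_ji andbT.
by rewrite ltn_eqF.
Qed.

Lemma lower_toeplitzC (K : comPzRingType) n (f g : nat -> K) :
  lower_toeplitz n f *m lower_toeplitz n g = lower_toeplitz n g *m lower_toeplitz n f.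
Proof.
rewrite !mul_lower_toeplitz; apply/matrixP => i j; rewrite !mxE.
by case: ifP => // _; apply: convC.
Qed.

(** The Toeplitz matrix of the geometric series [1 / (1 - t u)]. *)
Definition geom (K : pzRingType) n (t : K) : 'M[K]_n :=
  lower_toeplitz n (fun k => t ^+ k).

Definition is_lower_toeplitz (K : pzRingType) n (A : 'M[K]_n) :=
  exists f, A = lower_toeplitz n f.

Lemma is_lower_toeplitz_geomX (K : pzRingType) n (t : K) a :
  is_lower_toeplitz (geom n.+1 t ^+ a).
Proof.
elim: a => [|a [f IHa]]; first by rewrite expr0; eexists; apply: lower_toeplitz1.
by rewrite exprS IHa; eexists; apply: mul_lower_toeplitz.
Qed.

Definition shift (K : pzRingType) n j : 'M[K]_n := \matrix_(i, k) ((i + j == k)%N)%:R.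

Lemma shift_mul (K : pzRingType) n j (A : 'M[K]_n) (i k : 'I_n)
    (lt_ij : (i + j < n)%N) :
  (shift K n j *m A) i k = A (Ordinal lt_ij) k.
Proof.
rewrite mxE (bigD1 (Ordinal lt_ij)) //= big1 ?addr0; last first.
  move=> l ne_l; rewrite mxE (_ : _ == _ = false) ?mul0r //.
  by apply: contraNF ne_l => /eqP eq_l; apply/eqP/val_inj.
by rewrite mxE /= eqxx mul1r.
Qed.

Lemma mul_shift (K : pzRingType) n j (f : nat -> K) (i k : 'I_n) :
  (lower_toeplitz n f *m shift K n j) i k
  = if (j <= k <= i + j)%N then f (i + j - k)%N else 0.
Proof.
rewrite mxE; case: (leqP j k) => [le_jk|lt_kj] /=; last first.
  by rewrite big1 // => l _; rewrite mxE [shift _ _ _ _ _]mxE gtn_eqF ?mulr0 //; lia.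
have lt_kjn : (k - j < n)%N by have := ltn_ord k; lia.
rewrite (bigD1 (Ordinal lt_kjn)) //= big1 ?addr0; last first.
  move=> l ne_l; rewrite [shift _ _ _ _ _]mxE (_ : _ == _ = false) ?mulr0 //.
  apply: contraNF ne_l => /eqP eq_l; apply/eqP/val_inj => /=; lia.
rewrite !mxE /= subnK // eqxx mulr1 leq_subLR addnC.
by case: ifP => // _; congr f; lia.
Qed.

Definition upper_toeplitz (K : pzRingType) n m (u : nat -> K) : 'M[K]_n :=
  \sum_(j < m.+1) u j *: shift K n j.

(** The entry [(i, k)] of the product on the left is the sum of the
    [u_j t^(i + j - k)] with [k <= i + j]; in the product of [geom t] and
    [upper_toeplitz m u] only the terms with [j <= k] occur.  The missing ones
    add up to [t^i] times a factor that depends on [k] only, and [t^i] is the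
    entry [(i, 0)] of the latter product.  The bound on [i] keeps the rows
    [i + j] inside the matrix. *)
Lemma mul_upper_toeplitz_geom (K : comPzRingType) n m (u : nat -> K) t (i k : 'I_n.+1) :
  u 0%N = 1 -> (i + m <= n)%N ->
  (upper_toeplitz n.+1 m u *m geom n.+1 t) i k
  = (geom n.+1 t *m upper_toeplitz n.+1 m u
      *m row_update ord0
           (fun k : 'I_n.+1 => \sum_(j < m.+1 | (k < j)%N) u j * t ^+ (j - k))) i k.
Proof.
move=> u0 le_imn; rewrite mul_mx_row_update.
have entry l : (geom n.+1 t *m upper_toeplitz n.+1 m u) i l
    = \sum_(j < m.+1) u j * (if (j <= l <= i + j)%N then t ^+ (i + j - l)%N else 0).
  rewrite /upper_toeplitz mulmx_sumr summxE; apply: eq_bigr => j _.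
  by rewrite -scalemxAr mxE mul_shift.
rewrite !entry; have -> : \sum_(j < m.+1) u j * (if (j <= (ord0 : 'I_n.+1) <= i + j)%N
    then t ^+ (i + j - (ord0 : 'I_n.+1))%N else 0) = t ^+ i.
  rewrite big_ord_recl /= u0 mul1r addn0 subn0 big1 ?addr0 // => j _.
  by rewrite mulr0.
rewrite [X in _ * X]big_mkcond mulr_sumr -big_split /=.
rewrite mulmx_suml summxE; apply: eq_bigr => j _.
have lt_ij : (i + j < n.+1)%N by have := ltn_ord j; lia.
rewrite -scalemxAl mxE (shift_mul _ _ lt_ij) mxE /=.
case: (ltnP k j) => [lt_kj|le_jk] /=; last by rewrite mulr0 addr0.
rewrite mulr0 add0r ifT; last by lia.
by rewrite mulrCA -exprD; congr (_ * _ ^+ _); lia.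
Qed.

(** The determinant of the update in [mul_upper_toeplitz_geom] is the value at
    [t] of the polynomial with coefficients [u]. *)
Lemma minor_geom_move (K : comPzRingType) n m (u : nat -> K) (t : K)
    (S : {set 'I_n.+1}) (P : 'M[K]_n.+1) :
  u 0%N = 1 -> ord0 \in S -> {in S, forall i : 'I_n.+1, (i + m <= n)%N} ->
  is_lower_toeplitz P ->
  principal_minor S (P *m upper_toeplitz n.+1 m u *m geom n.+1 t)
  = (\sum_(j < m.+1) u j * t ^+ j)
      * principal_minor S (geom n.+1 t *m P *m upper_toeplitz n.+1 m u).
Proof.
move=> u0 S0 S_small [f ->].
rewrite -[geom _ _ *m lower_toeplitz _ _]lower_toeplitzC.
pose r (k : 'I_n.+1) := \sum_(j < m.+1 | (k < j)%N) u j * t ^+ (j - k).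
have -> : \sum_(j < m.+1) u j * t ^+ j = 1 + r ord0.
  rewrite /r big_ord_recl u0 mul1r [X in _ = _ + X]big_mkcond big_ord_recl /= add0r.
  by congr (_ + _); apply: eq_bigr => j _; rewrite subn0.
rewrite -minor_mul_row_update //; apply: minor_eq => i k iS.
rewrite -!mulmxA !mxE; apply: eq_bigr => l _.
rewrite mxE; case: leqP => [le_li|_]; last by rewrite !mul0r.
congr (_ * _); rewrite mulmxA mul_upper_toeplitz_geom //.
by have := S_small i iS; lia.
Qed.

(** * Rotating the Toeplitz factors modulo a power of the indeterminate *)

Definition eqXn (F : fieldType) D (p q : {poly F}) := 'X^D %| p - q.

Lemma eqXn_refl (F : fieldType) D (p : {poly F}) : eqXn D p p.
Proof. by rewrite /eqXn subrr dvdp0. Qed.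

Lemma eqXn_trans (F : fieldType) D (p q r : {poly F}) :
  eqXn D p q -> eqXn D q r -> eqXn D p r.
Proof. by move=> pq qr; rewrite /eqXn -(subrKA q) dvdp_add. Qed.

Lemma eqXnD (F : fieldType) D (p q p' q' : {poly F}) :
  eqXn D p q -> eqXn D p' q' -> eqXn D (p + p') (q + q').
Proof. by move=> pq pq'; rewrite /eqXn opprD addrACA dvdp_add. Qed.

Lemma eqXnM (F : fieldType) D (p q p' q' : {poly F}) :
  eqXn D p q -> eqXn D p' q' -> eqXn D (p * p') (q * q').
Proof.
move=> pq pq'; rewrite /eqXn (_ : _ - _ = (p - q) * p' + q * (p' - q')).
  by apply: dvdp_add; [apply: dvdp_mulr | apply: dvdp_mull].
by ring.
Qed.

Lemma eqXn_coef (F : fieldType) D (p q : {poly F}) d :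
  eqXn D p q -> (d < D)%N -> p`_d = q`_d.
Proof.
move=> /dvdpP[r eq_r] lt_dD; apply/eqP; rewrite -subr_eq0 -coefB eq_r.
by rewrite coefMXn lt_dD.
Qed.

Lemma eqXnP (F : fieldType) D (p q : {poly F}) :
  (forall d, (d < D)%N -> p`_d = q`_d) -> eqXn D p q.
Proof.
move=> eq_pq; rewrite /eqXn -[p - q](poly_take_drop D).
rewrite (_ : take_poly D _ = 0) ?add0r ?dvdp_mull //.
apply/polyP => d; rewrite coef_take_poly coef0 coefB; case: ltnP => // /eq_pq->.
exact: subrr.
Qed.

Lemma eqXn_sum (F : fieldType) D (I : Type) (r : seq I) (P : pred I)
    (f g : I -> {poly F}) :
  (forall i, P i -> eqXn D (f i) (g i)) ->
  eqXn D (\sum_(i <- r | P i) f i) (\sum_(i <- r | P i) g i).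
Proof.
move=> eq_fg; apply: (big_ind2 (eqXn D)) => //; first exact: eqXn_refl.
by move=> *; apply: eqXnD.
Qed.

Lemma eqXn_prod (F : fieldType) D (I : Type) (r : seq I) (P : pred I)
    (f g : I -> {poly F}) :
  (forall i, P i -> eqXn D (f i) (g i)) ->
  eqXn D (\prod_(i <- r | P i) f i) (\prod_(i <- r | P i) g i).
Proof.
move=> eq_fg; apply: (big_ind2 (eqXn D)) => //; first exact: eqXn_refl.
by move=> *; apply: eqXnM.
Qed.

(** These are the two conditions on index sets in [minor_geom_move]: sets that
    omit [0] or contain a large element have a large sum. *)
Lemma small_sum_set M (S : {set 'I_M.+1}) d :
  ((\sum_(i in S) i)%N <= 'C(#|S|, 2) + d)%N -> (d < #|S|)%N ->
  ord0 \in S /\ {in S, forall i : 'I_M.+1, (i < #|S| + d)%N}.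
Proof.
have [s [e [s_sorted s_gt0 size_S mem_S ->]]] := set_betaP S => le_sd lt_dS.
have size_s := size_leq_sumn s_gt0.
split=> [|i].
  rewrite mem_S; have : (0 < e)%N by lia.
  elim: s {s_sorted s_gt0 size_S mem_S le_sd size_s} => [|a s IHs] e_gt0 /=.
    by rewrite mem_rev mem_iota.
  by rewrite inE IHs ?orbT.
move: le_sd; rewrite addnC leq_add2l => le_sd.
rewrite mem_S => /beta_lt /leq_trans; apply.
by rewrite -addnA size_S addnC leq_add2l.
Qed.

Definition Xdiag (F : fieldType) n : 'M[{poly F}]_n := diag_mx (\row_i 'X^i).

Lemma minor_Xdiag (F : fieldType) n (S : {set 'I_n}) A :
  principal_minor S (Xdiag F n *m A) = 'X^(\sum_(i in S) i) * principal_minor S A.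
Proof.
rewrite minor_diag expr_sum; congr (_ * _).
by apply: eq_bigr => i _; rewrite mxE.
Qed.

Lemma Xdiag_geom (F : fieldType) n (t : {poly F}) :
  Xdiag F n *m geom n t = geom n ('X * t) *m Xdiag F n.
Proof.
rewrite mul_diag_mx mul_mx_diag; apply/matrixP => i j; rewrite !mxE.
case: leqP => [le_ji|_]; last by rewrite mulr0 mul0r.
rewrite exprMn mulrAC -exprD subnK //.
Qed.

Lemma geom_unit (F : fieldType) n (t : {poly F}) : geom n t \in unitmx.
Proof.
rewrite unitmxE det_trig ?big1 ?unitr1 // => [i _|].
  by rewrite !mxE leqnn subnn.
by apply/is_trig_mxP => i j lt_ij; rewrite mxE leqNgt lt_ij.
Qed.

(** The coefficient of [t^j] in [(1 - t)^m]. *)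
Definition one_sub_coef (K : pzRingType) m (j : nat) : K := (-1) ^+ j * 'C(m, j)%:R.

Lemma one_sub_coefE (K : comPzRingType) m (t : K) :
  \sum_(j < m.+1) one_sub_coef K m j * t ^+ j = (1 - t) ^+ m.
Proof.
rewrite exprBn; apply: eq_bigr => j _.
by rewrite expr1n mulr1 -mulr_natr mulrAC.
Qed.

Definition one_sub_mx (K : pzRingType) n m : 'M[K]_n :=
  upper_toeplitz n m (one_sub_coef K m).

(** The factor [geom t] crosses [Xdiag], is rotated to the right end and
    commuted back through [one_sub_mx].  The index sets to which
    [minor_geom_move] does not apply contribute multiples of the modulus. *)
Lemma minor_sum_step (F : fieldType) n N d m (t : {poly F}) P :
  (d < N)%N -> (N + d + m <= n)%N -> is_lower_toeplitz P ->
  eqXn ('C(N, 2) + d).+1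
    (minor_sum N (Xdiag F n.+1 *m (geom n.+1 t *m P *m one_sub_mx _ n.+1 m)))
    ((1 - 'X * t) ^+ m
      * minor_sum N (Xdiag F n.+1 *m (geom n.+1 ('X * t) *m P *m one_sub_mx _ n.+1 m))).
Proof.
move=> lt_dN le_n P_lower; set U := one_sub_mx _ _ _.
rewrite -!mulmxA [Xdiag _ _ *m _]mulmxA Xdiag_geom -mulmxA.
rewrite minor_sum_mulC ?geom_unit // mulr_sumr -!mulmxA.
apply: eqXn_sum => S /eqP card_S; rewrite !minor_Xdiag mulrCA.
have [le_S|lt_S] := leqP (\sum_(i in S) i)%N ('C(N, 2) + d)%N; last first.
  by rewrite /eqXn dvdp_sub // dvdp_mulr // dvdp_exp2l.
have [] := small_sum_set (S := S) (d := d); rewrite ?card_S // => S0 S_lt.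
rewrite -one_sub_coefE [P *m (_ *m _)]mulmxA minor_geom_move ?mulmxA ?eqXn_refl //.
  by rewrite /one_sub_coef expr0 bin0 mul1r.
by move=> i /S_lt; lia.
Qed.

Lemma minor_sum_round (F : fieldType) n N d m a (t : {poly F}) :
  (d < N)%N -> (N + d + m <= n)%N ->
  eqXn ('C(N, 2) + d).+1
    (minor_sum N (Xdiag F n.+1 *m (geom n.+1 t ^+ a *m one_sub_mx _ n.+1 m)))
    ((1 - 'X * t) ^+ (m * a)
      * minor_sum N (Xdiag F n.+1 *m (geom n.+1 ('X * t) ^+ a *m one_sub_mx _ n.+1 m))).
Proof.
(* Here [b] factors have been moved and [a] factors are left. *)
move=> lt_dN le_n; suff: forall b, eqXn ('C(N, 2) + d).+1
    (minor_sum N (Xdiag F n.+1 *m (geom n.+1 ('X * t) ^+ b *m geom n.+1 t ^+ a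
                               *m one_sub_mx _ n.+1 m)))
    ((1 - 'X * t) ^+ (m * a)
      * minor_sum N (Xdiag F n.+1 *m (geom n.+1 ('X * t) ^+ (a + b)
                                 *m one_sub_mx _ n.+1 m))).
  by move/(_ 0%N); rewrite expr0 mul1mx addn0.
elim: a => [|a IHa] b; first by rewrite muln0 expr0 mul1r mulmx1 eqXn_refl.
have [f Pf] := is_lower_toeplitz_geomX n ('X * t) b.
have [g Pg] := is_lower_toeplitz_geomX n t a.
have -> : geom n.+1 ('X * t) ^+ b *m geom n.+1 t ^+ a.+1
  = geom n.+1 t *m (geom n.+1 ('X * t) ^+ b *m geom n.+1 t ^+ a).
  by rewrite exprS Pf [_ * _]/(_ *m _) !mulmxA lower_toeplitzC.
apply: eqXn_trans (minor_sum_step t lt_dN le_n _) _.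
  by rewrite Pf Pg mul_lower_toeplitz; eexists.
rewrite mulnS exprD -mulrA; apply: eqXnM (eqXn_refl _ _) _.
rewrite mulmxA [geom _ _ *m _](_ : _ = geom n.+1 ('X * t) ^+ b.+1);
  last by rewrite exprS.
by have := IHa b.+1; rewrite addnS.
Qed.

Lemma minor_sum_rounds (F : fieldType) n N d m k :
  (d < N)%N -> (N + d + m <= n)%N ->
  eqXn ('C(N, 2) + d).+1
    (minor_sum N (Xdiag F n.+1 *m (geom n.+1 1 ^+ m *m one_sub_mx _ n.+1 m)))
    ((\prod_(i < k) (1 - 'X^(i.+1)) ^+ (m * m))
      * minor_sum N (Xdiag F n.+1 *m (geom n.+1 'X^k ^+ m *m one_sub_mx _ n.+1 m))).
Proof.
move=> lt_dN le_n; elim: k => [|k IHk]; first by rewrite big_ord0 mul1r eqXn_refl.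
apply: eqXn_trans IHk _; rewrite big_ord_recr /= -mulrA.
apply: eqXnM (eqXn_refl _ _) _; rewrite exprS.
exact: minor_sum_round.
Qed.

(** * Evaluation of the generating series *)

Lemma upper_toeplitz_below (K : pzRingType) n m (u : nat -> K) (i k : 'I_n) :
  (k <= i)%N ->
  upper_toeplitz n m u i k = (i == k)%:R * u 0%N.
Proof.
move=> le_ki; rewrite summxE big_ord_recl big1 /= ?addr0 => [|j _].
  rewrite !mxE addn0 val_eqE; case: eqP => _; first by rewrite mulr1 mul1r.
  by rewrite mulr0 mul0r.
by rewrite !mxE gtn_eqF ?mulr0 // /bump; lia.
Qed.

Lemma minor_one_sub_mx (K : comPzRingType) n m (S : {set 'I_n}) :
  principal_minor S (one_sub_mx K n m) = 1.
Proof.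
rewrite /principal_minor -det_tr det_trig ?big1 // => [i _|].
  rewrite !mxE; case: ifP => _; last by rewrite eqxx.
  by rewrite upper_toeplitz_below // eqxx /one_sub_coef bin0 !mulr1.
apply/is_trig_mxP => i j lt_ij; rewrite !mxE.
have ne_ji : (j == i) = false by rewrite -val_eqE /= gtn_eqF.
by case: ifP => _; rewrite ?upper_toeplitz_below ?ne_ji ?mul0r // ltnW.
Qed.

Lemma eqXn_det (F : fieldType) D n (A B : 'M[{poly F}]_n) :
  (forall i j, eqXn D (A i j) (B i j)) -> eqXn D (\det A) (\det B).
Proof.
move=> eqAB; apply: eqXn_sum => s _; apply: eqXnM (eqXn_refl _ _) _.
by apply: eqXn_prod => i _.
Qed.

Lemma eqXn_mulmx (F : fieldType) D n (A B A' B' : 'M[{poly F}]_n) :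
  (forall i j, eqXn D (A i j) (B i j)) -> (forall i j, eqXn D (A' i j) (B' i j)) ->
  forall i j, eqXn D ((A *m A') i j) ((B *m B') i j).
Proof.
by move=> eqAB eqAB' i j; rewrite !mxE; apply: eqXn_sum => k _; apply: eqXnM.
Qed.

Lemma eqXn_geom (F : fieldType) D n a (i j : 'I_n.+1) :
  eqXn D ((geom n.+1 ('X^D : {poly F}) ^+ a) i j) ((1%:M : 'M_n.+1) i j).
Proof.
elim: a i j => [|a IHa] i j; first by rewrite expr0 eqXn_refl.
rewrite exprS -[1%:M]mulmx1; apply: eqXn_mulmx => // {i j} i j.
rewrite !mxE; case: leqP => [le_ji|lt_ij]; last first.
  by rewrite -val_eqE /= ltn_eqF // eqXn_refl.
have [->|ne_ij] := eqVneq i j; first by rewrite subnn expr0 eqXn_refl.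
rewrite /eqXn subr0 -(prednK (n := i - j)) ?exprS ?dvdp_mulr //.
by rewrite subn_gt0 ltn_neqAle le_ji andbT eq_sym.
Qed.

(** Modulo ['X^D] the matrix [geom 'X^D] is the identity, and [one_sub_mx] is
    unitriangular, so all minors become [1]. *)
Lemma minor_sum_base (F : fieldType) n N D m :
  eqXn D (minor_sum N (Xdiag F n.+1 *m (geom n.+1 'X^D ^+ m *m one_sub_mx _ n.+1 m)))
    (\sum_(S : {set 'I_n.+1} | #|S| == N) 'X^(\sum_(i in S) i)).
Proof.
apply: eqXn_sum => S _; rewrite minor_Xdiag -[X in eqXn _ _ X]mulr1.
apply: eqXnM (eqXn_refl _ _) _; rewrite -(minor_one_sub_mx _ m S).
apply: eqXn_det => i j; rewrite !mxE; case: ifP => _; last exact: eqXn_refl.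
have := eqXn_mulmx (@eqXn_geom F D n m)
  (fun i j => eqXn_refl D (one_sub_mx _ n.+1 m i j)) i j.
by rewrite mul1mx mxE.
Qed.

(** In characteristic zero, the binomial coefficient [C(z + j, j)]. *)
Definition rising (F : fieldType) (z : F) j : F :=
  \prod_(1 <= h < j.+1) ((h%:R + z) / h%:R).

Lemma rising0 (F : fieldType) (z : F) : rising z 0 = 1.
Proof. by rewrite /rising big_geq. Qed.

Lemma risingS (F : fieldType) (z : F) j :
  rising z j.+1 = rising z j * ((j.+1%:R + z) / j.+1%:R).
Proof. by rewrite /rising big_nat_recr. Qed.

(** Pascal's rule. *)
Lemma rising_sub1 (F : numFieldType) (z : F) j :
  rising (z - 1) j.+1 = rising z j.+1 - rising z j.
Proof.
elim: j => [|j IHj]; first by rewrite !risingS !rising0; field.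
rewrite risingS IHj !risingS; field.
by rewrite nat1r -natrD !pnatr_eq0.
Qed.

Definition gen_rising (F : fieldType) (n k : nat) (z : F) : {poly F} :=
  \prod_(i < k) \sum_(j < n.+1) rising z j *: 'X^(i.+1 * j).

(** [rising_sub1] in each factor; the truncation of the series leaves a term of
    degree larger than [n]. *)
Lemma gen_rising_sub1 (F : numFieldType) n k (z : F) :
  eqXn n.+1 (\prod_(i < k) (1 - 'X^(i.+1)) * gen_rising n k z)
            (gen_rising n k (z - 1)).
Proof.
rewrite -big_split; apply: eqXn_prod => i _ /=.
have -> : (1 - 'X^(i.+1)) * (\sum_(j < n.+1) rising z j *: 'X^(i.+1 * j))
  = \sum_(j < n.+1) rising (z - 1) j *: 'X^(i.+1 * j)
     - rising z n *: 'X^(i.+1 * n.+1).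
  elim: n => [|n IHn].
    by rewrite !big_ord1 !rising0 !muln0 !muln1 expr0 !scale1r mulr1.
  rewrite big_ord_recr mulrDr IHn [in RHS]big_ord_recr /=.
  rewrite rising_sub1 scalerBl mulrBl mul1r -scalerAr -exprD -mulnS.
  by ring.
rewrite /eqXn addrAC subrr sub0r dvdpNr -mul_polyC dvdp_mull //.
by rewrite dvdp_exp2l // leq_pmull.
Qed.

Lemma gen_rising_subn (F : numFieldType) n k (z : F) c :
  eqXn n.+1 (\prod_(i < k) (1 - 'X^(i.+1)) ^+ c * gen_rising n k z)
            (gen_rising n k (z - c%:R)).
Proof.
elim: c z => [|c IHc] z.
  by rewrite subr0 big1 ?mul1r ?eqXn_refl // => i _; rewrite expr0.
under eq_bigr do rewrite exprSr.
rewrite big_split -mulrA /=.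
apply: eqXn_trans (eqXnM (eqXn_refl _ _) (gen_rising_sub1 _ _ _)) _.
by rewrite mulrS opprD addrA; apply: IHc.
Qed.

(** Both sides count partitions, on the left through beta sets and on the right
    through row differences, since all weights [rising 0 j] are [1]. *)
Lemma sum_sets_gen (F : numFieldType) M N d k :
  (d < N)%N -> (N + d <= M.+1)%N -> (d <= k)%N ->
  eqXn ('C(N, 2) + d).+1
    (\sum_(S : {set 'I_M.+1} | #|S| == N) 'X^(\sum_(i in S) i))
    ('X^('C(N, 2)) * gen_rising d k (0 : F)).
Proof.
move=> lt_dN le_NM le_dk; apply: eqXnP => e lt_e; rewrite coefXnM coef_sum.
under eq_bigr => S _ do rewrite coefXn eq_sym.
case: ltnP => [lt_eB|le_Be].
  rewrite big1 // => S /eqP card_S.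
  have [s [e' [_ _ _ _ sum_S]]] := set_betaP S.
  by rewrite gtn_eqF // sum_S card_S; lia.
have [e' def_e] : exists e', e = ('C(N, 2) + e')%N by exists (e - 'C(N, 2))%N; lia.
rewrite def_e addKn coef_gen_row_diffs; [|lia|lia].
transitivity (\sum_(S : {set 'I_M.+1} | (#|S| == N)
        && ((\sum_(i in S) i)%N == 'C(N, 2) + e')%N) (1 : F)).
  by rewrite [RHS]big_mkcondr; apply: eq_bigr => S _; case: eqP.
rewrite (sum_intpart_sets (fun=> 1)); [|lia|lia].
apply: eq_bigr => p _; rewrite big1 // => i _.
rewrite /rising big_nat_cond big1 // => h /andP[/andP[h_gt0 _] _].
by rewrite addr0 divff // pnatr_eq0 -lt0n.
Qed.

(** Both sides arise from the generating series of the number of partitions by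
    multiplication with the [(1 - x^k)^(m^2)]: the left one by
    [minor_sum_rounds], the right one by [gen_rising_subn]. *)
Lemma sum_minors (F : numFieldType) n N d m :
  (d < N)%N -> (N + d + m <= n)%N ->
  \sum_(S : {set 'I_n.+1} | (#|S| == N)
        && ((\sum_(i in S) i)%N == 'C(N, 2) + d)%N)
    principal_minor S (geom n.+1 (1 : F) ^+ m *m one_sub_mx F n.+1 m)
  = \sum_(p : intpart d) \prod_(h <- hooks_trivial_leg p)
       ((h%:R - (m * m)%:R) / h%:R).
Proof.
move=> lt_dN le_n.
(* After [D] rounds the powers of [geom] are the identity modulo the power in use. *)
set D := ('C(N, 2) + d).+1; set A := _ *m _.
have -> : \sum_(S : {set 'I_n.+1} | (#|S| == N)
    && ((\sum_(i in S) i)%N == 'C(N, 2) + d)%N) principal_minor S A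
  = (minor_sum N (Xdiag F n.+1 *m (geom n.+1 1 ^+ m *m one_sub_mx _ n.+1 m)))
    `_('C(N, 2) + d).
  have -> : geom n.+1 1 ^+ m *m one_sub_mx _ n.+1 m = map_mx polyC A.
    rewrite map_mxM rmorphXn /=; congr (_ ^+ _ *m _); apply/matrixP => i j.
      by rewrite !mxE; case: ifP; rewrite // !expr1n.
    rewrite mxE !summxE rmorph_sum /=; apply: eq_bigr => k _.
    rewrite !mxE rmorphM /one_sub_coef rmorphM rmorphXn rmorphN1 /=.
    by rewrite !rmorph_nat.
  rewrite /minor_sum coef_sum big_mkcondr; apply: eq_bigr => S _.
  rewrite minor_Xdiag.
  have -> : principal_minor S (map_mx polyC A) = (principal_minor S A)%:P.
    rewrite /principal_minor -det_map_mx; congr (\det _); apply/matrixP => i j.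
    by rewrite !mxE; case: ifP => // _; rewrite rmorph_nat.
  by rewrite mulrC coefCM coefXn eq_sym; case: eqP; rewrite ?mulr1 ?mulr0.
rewrite (eqXn_coef (minor_sum_rounds _ D lt_dN le_n)) //.
have le1 : (N + d <= n.+1)%N by lia.
have le2 : (d <= D)%N by rewrite /D; lia.
have := eqXn_trans (minor_sum_base F n N D m) (sum_sets_gen F lt_dN le1 le2).
move=> /(eqXnM (eqXn_refl D (\prod_(i < D) (1 - 'X^(i.+1)) ^+ (m * m)))).
move=> /eqXn_coef/(_ (ltnSn _)) ->.
rewrite mulrCA coefXnM ltnNge leq_addr /= addKn.
rewrite (eqXn_coef (gen_rising_subn _ _ _ _)) // coef_gen_row_diffs //.
apply: eq_bigr => p _; have [p_sorted _ _ size_p] := intpart_facts p.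
rewrite (big_hooks_trivial_leg _ p_sorted (leq_trans size_p le2)).
by apply: eq_bigr => i _; apply: eq_bigr => h _; rewrite sub0r.
Qed.

(** * Entries of the Toeplitz product *)

(** The coefficients of [1 / (1 - u)^(m + 1)]. *)
Lemma geom1X (K : pzRingType) n m :
  geom n.+1 (1 : K) ^+ m.+1 = lower_toeplitz n.+1 (fun k => 'C(m + k, k)%:R).
Proof.
elim: m => [|m IHm].
  rewrite expr1; apply/matrixP => i j; rewrite !mxE; case: ifP => // _.
  by rewrite expr1n add0n binn.
rewrite exprS IHm [_ * _]mul_lower_toeplitz; apply/matrixP => i j; rewrite !mxE.
case: ifP => // _; rewrite /conv.
elim: (i - j)%N => [|k IHk].
  by rewrite big_ord1 expr0 mul1r subnn !bin0.
rewrite big_ord_recl expr0 mul1r subn0 [in RHS]addnS binS natrD addSnnS; congr (_ + _).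
by rewrite -addSnnS -IHk; apply: eq_bigr => c _; rewrite !expr1n.
Qed.

(** The entry [(i, j)], for [j <= m], of [geom 1 ^+ m.+1 *m one_sub_mx m.+1] as a
    function of natural numbers. *)
Definition toeplitz_entry (F : pzRingType) (m i j : nat) : F :=
  \sum_(l < j.+1) one_sub_coef F m.+1 l
     * (if (j <= i + l)%N then 'C(m + (i + l - j), i + l - j)%:R else 0).

Lemma binS_rising (F : numFieldType) m i :
  'C(m + i.+1, i.+1)%:R * i.+1%:R = m.+1%:R * rising (m.+1%:R : F) i.
Proof.
elim: i => [|i IHi].
  by rewrite rising0 bin1 addn1.
have := mul_bin_diag (m + i.+2) i.+1; rewrite addnS /= => /(congr1 (fun k => k%:R : F)).
rewrite !natrM mulrC => eq_bin.
rewrite [LHS](etrans (mulrC _ _) (esym eq_bin)) risingS mulrA -IHi addnS natrD.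
by field; rewrite nat1r pnatr_eq0.
Qed.

Lemma one_sub_coefS_rising (F : numFieldType) m j : (j <= m)%N ->
  one_sub_coef F m.+1 j.+1 * j.+1%:R = - m.+1%:R * rising (- m.+1%:R : F) j.
Proof.
elim: j => [_|j IHj lt_jm].
  by rewrite rising0 /one_sub_coef bin1 expr1 !mulr1 mulN1r.
have := mul_bin_left m.+1 j.+1 => /(congr1 (fun k => k%:R : F)).
rewrite !natrM natrB ?(leqW lt_jm) // => eq_bin.
rewrite risingS [RHS]mulrA -IHj ?(ltnW lt_jm) // /one_sub_coef exprS -[LHS]mulrA.
rewrite [X in _ * X]mulrC [X in _ * X](eq_bin : _ = _ :> F).
by field; rewrite nat1r pnatr_eq0.
Qed.

Lemma toeplitz_entry0r (F : numFieldType) m i :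
  toeplitz_entry F m i 0 = 'C(m + i, i)%:R.
Proof.
by rewrite /toeplitz_entry big_ord1 /= addn0 subn0 /one_sub_coef bin0 !mul1r.
Qed.

Lemma toeplitz_entry0l (F : numFieldType) m j :
  toeplitz_entry F m 0 j = one_sub_coef F m.+1 j.
Proof.
rewrite /toeplitz_entry big_ord_recr /= add0n leqnn subnn bin0 mulr1 big1 ?add0r //.
by move=> l _; rewrite add0n leqNgt ltn_ord mulr0.
Qed.

Lemma toeplitz_entrySS (F : numFieldType) m i j : toeplitz_entry F m i.+1 j.+1
  = toeplitz_entry F m i j + one_sub_coef F m.+1 j.+1 * 'C(m + i.+1, i.+1)%:R.
Proof.
rewrite /toeplitz_entry big_ord_recr /= leq_addl addnK; congr (_ + _).
Qed.

(** By [toeplitz_entrySS] the entries change along a diagonal by products of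
    coefficients.  With [M = m.+1], the induction rests on the identity
    [(i + 1) (j + 1) - M (M + i - j) = (M + i + 1) (j + 1 - M)]. *)
Lemma toeplitz_entryE (F : numFieldType) m i j : (j <= m)%N ->
  (m.+1%:R + i%:R - j%:R) * toeplitz_entry F m i j
  = m.+1%:R * rising (m.+1%:R : F) i * rising (- m.+1%:R : F) j.
Proof.
elim: j i => [|j IHj] [|i] le_jm.
- by rewrite toeplitz_entry0r !rising0 bin0; ring.
- rewrite toeplitz_entry0r rising0 !mulr1 risingS mulrA -binS_rising.
  by field; rewrite nat1r pnatr_eq0.
- rewrite toeplitz_entry0l rising0 mulr1 risingS.
  have eq_q := one_sub_coefS_rising F (ltnW le_jm).
  have {eq_q}-> : one_sub_coef F m.+1 j.+1
      = - m.+1%:R * rising (- m.+1%:R : F) j / j.+1%:R.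
    by rewrite -eq_q mulfK // pnatr_eq0.
  by field; rewrite nat1r pnatr_eq0.
rewrite toeplitz_entrySS mulrDr.
have eq_q := one_sub_coefS_rising F (ltnW le_jm).
have {eq_q}-> : one_sub_coef F m.+1 j.+1
    = - m.+1%:R * rising (- m.+1%:R : F) j / j.+1%:R.
  by rewrite -eq_q mulfK // pnatr_eq0.
have eq_p := binS_rising F m i.
have {eq_p}-> : 'C(m + i.+1, i.+1)%:R
    = m.+1%:R * rising (m.+1%:R : F) i / i.+1%:R.
  by rewrite -eq_p mulfK // pnatr_eq0.
have -> : m.+1%:R + i.+1%:R - j.+1%:R = m.+1%:R + i%:R - j%:R :> F.
  by rewrite -!natr1; ring.
rewrite IHj ?(ltnW le_jm) // !risingS.
by field; rewrite !nat1r !pnatr_eq0.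
Qed.

(** * The Cauchy minors and the polynomial identity in z *)

Lemma geom_one_sub_entry (F : numFieldType) n m (i j : 'I_n.+1) : (j <= m)%N ->
  (geom n.+1 (1 : F) ^+ m.+1 *m one_sub_mx F n.+1 m.+1) i j = toeplitz_entry F m i j.
Proof.
move=> le_jm; rewrite geom1X /one_sub_mx /upper_toeplitz mulmx_sumr summxE.
rewrite /toeplitz_entry.
rewrite (big_ord_widen m.+2 (fun l => one_sub_coef F m.+1 l
     * (if (j <= i + l)%N then 'C(m + (i + l - j), i + l - j)%:R else 0))); last by lia.
rewrite [RHS]big_mkcond; apply: eq_bigr => l _.
rewrite -scalemxAr mxE mul_shift ltnS.
by case: leqP; rewrite ?mulr0.
Qed.

Lemma pairprod_inv (F : fieldType) (I : eqType) (g k : I -> I -> F) t :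
  pairwise (fun a b => k a b * g a b == 1) t -> pairprod k t * pairprod g t = 1.
Proof.
elim: t => [_|a t IHt] /=; first by rewrite mulr1.
case/andP => /allP kg1 /IHt kg2; rewrite mulrACA kg2 mulr1 -big_split big1_seq //=.
by move=> b /kg1/eqP.
Qed.

Lemma pairprod_map (K : pzRingType) (I J : Type) (f : I -> J) (g : J -> J -> K) t :
  pairprod g (map f t) = pairprod (fun a b => g (f a) (f b)) t.
Proof. by elim: t => //= a t ->; rewrite big_map. Qed.

(** The Cauchy determinant with [x_i = M + i] and [y_j = j], where [M = m.+1]
    exceeds all beta numbers, so that no denominator vanishes.  For
    [g h = (h^2 - M^2) / h^2], the diagonal entry at [a] is the product of
    [g 1, ..., g a] and the factor of a pair [b < a] is the inverse of
    [g (a - b)], which is what [hooks_pairprod] requires. *)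
Lemma minor_hooks (F : numFieldType) n N d m (p : intpart d) :
  (d <= N)%N -> (N + d <= m)%N -> (m <= n)%N ->
  principal_minor [set i in beta_ord n N p]
    (geom n.+1 (1 : F) ^+ m.+1 *m one_sub_mx F n.+1 m.+1)
  = \prod_(h <- hooks p) ((h%:R ^+ 2 - (m.+1 * m.+1)%:R) / h%:R ^+ 2).
Proof.
move=> le_dN le_Nm le_mn; set M := m.+1%:R : F.
have [p_sorted _ sum_p size_p] := intpart_facts p.
have le_Nn : (N + d <= n.+1)%N by lia.
have def_t := val_beta_ord p le_dN le_Nn.
have uniq_t := uniq_beta_ord p le_dN le_Nn.
set t := beta_ord n N p in def_t uniq_t *.
have lt_t (i : 'I_n.+1) : i \in t -> (i < m)%N.
  move=> it; have : val i \in beta (N - size p) p by rewrite -def_t map_f.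
  by move=> /beta_lt /leq_trans; apply; rewrite sum_p; lia.
have M0 : M != 0 by rewrite pnatr_eq0.
have ne_xy (i j : 'I_n.+1) : i \in t -> j \in t -> M + i%:R - j%:R != 0.
  move=> it /lt_t lt_j; rewrite /M -natrD subr_eq0 eqr_nat gtn_eqF //; lia.
rewrite (@minor_cauchy _ _ (fun i => M + i%:R) (fun i => i%:R)
   (fun i => M * rising M i) (fun j => rising (- M) j)) //; first last.
- move=> i j it jt.
  rewrite geom_one_sub_entry ?(ltnW (lt_t j jt)) //.
  rewrite -toeplitz_entryE ?(ltnW (lt_t j jt)) //.
  by rewrite mulrAC mulfV ?mul1r ?ne_xy.
- by move=> i j _ _ /eqP; rewrite eqr_nat => /eqP/val_inj.
- by move=> i j _ _ /addrI/eqP; rewrite eqr_nat => /eqP/val_inj.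
- move=> i it; have lt_i := lt_t i it; rewrite !mulf_neq0 // prodf_seq_neq0;
    apply/allP => h; rewrite mem_index_iota => /andP[h_gt0 le_hi] /=.
    by rewrite /M -natrD mulf_neq0 ?invr_eq0 // pnatr_eq0; lia.
  rewrite mulf_neq0 ?invr_eq0 ?pnatr_eq0 -?lt0n //.
  by rewrite subr_eq0 eqr_nat; lia.
pose g h : F := (h%:R ^+ 2 - (m.+1 * m.+1)%:R) / h%:R ^+ 2.
have diag : \prod_(i <- t) (geom n.+1 (1 : F) ^+ m.+1 *m one_sub_mx F n.+1 m.+1) i i
   = \prod_(a <- beta (N - size p) p) \prod_(1 <= h < a.+1) g h.
  rewrite -def_t big_map; apply: eq_big_seq => i it.
  have le_im := ltnW (lt_t i it).
  rewrite geom_one_sub_entry //; apply: (mulfI M0).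
  have := toeplitz_entryE F i le_im; rewrite addrK -/M => ->.
  rewrite -mulrA; congr (_ * _); rewrite /rising -big_split.
  apply: eq_big_nat => h /andP[h_gt0 _] /=; rewrite /g natrM -/M.
  by field; rewrite pnatr_eq0 -lt0n.
rewrite -[RHS]/(\prod_(h <- hooks p) g h) diag.
rewrite -(hooks_pairprod g _ p_sorted) -def_t pairprod_map -mulrA.
rewrite mulrC -[RHS]mul1r; congr (_ * _); rewrite mulrC.
apply: pairprod_inv.
have : pairwise (fun i j : 'I_n.+1 => (j < i)%N) t.
  rewrite -(pairwise_map val gtn) def_t -sorted_pairwise ?beta_sorted //.
  exact: rev_trans ltn_trans.
apply: (@sub_in_pairwise _ (mem t)) => [i j it jt lt_ji|]; last by apply/allP.
have lt_im := lt_t i it; have lt_jm := lt_t j jt.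
have ne1 := ne_xy i j it jt; have ne2 := ne_xy j i jt it.
have ne_ij : i%:R - j%:R != 0 :> F by rewrite subr_eq0 eqr_nat gtn_eqF.
rewrite /g natrM -/M natrB ?(ltnW lt_ji) //; apply/eqP.
by field; rewrite nat1r -/M ne_ij ne1 ne2.
Qed.

Lemma hook_identity_square (F : numFieldType) d m : (d + d < m)%N ->
  \sum_(p : intpart d) \prod_(h <- hooks_trivial_leg p)
       ((h%:R - (m.+1 * m.+1)%:R) / h%:R : F)
  = \sum_(p : intpart d) \prod_(h <- hooks p)
       ((h%:R ^+ 2 - (m.+1 * m.+1)%:R) / h%:R ^+ 2).
Proof.
move=> lt_dm; rewrite -(@sum_minors F (d.+1 + d + m.+1) d.+1 d m.+1) //.
rewrite sum_intpart_sets; [|lia|lia].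
by apply: eq_bigr => p _; apply: minor_hooks; lia.
Qed.

Lemma hook_identity (F : numFieldType) d (z : F) :
  \sum_(p : intpart d) \prod_(h <- hooks_trivial_leg p) ((h%:R + z) / h%:R)
  = \sum_(p : intpart d) \prod_(h <- hooks p) ((h%:R ^+ 2 + z) / h%:R ^+ 2).
Proof.
pose P : {poly F} := \sum_(p : intpart d)
  \prod_(h <- hooks_trivial_leg p) ((h%:R%:P + 'X) * (h%:R^-1)%:P).
pose Q : {poly F} := \sum_(p : intpart d)
  \prod_(h <- hooks p) (((h%:R ^+ 2)%:P + 'X) * ((h%:R ^+ 2)^-1)%:P).
have PE x : P.[x] = \sum_(p : intpart d)
    \prod_(h <- hooks_trivial_leg p) ((h%:R + x) / h%:R).
  rewrite horner_sum; apply: eq_bigr => p _; rewrite horner_prod.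
  by apply: eq_bigr => h _; rewrite !hornerE.
have QE x : Q.[x] = \sum_(p : intpart d)
    \prod_(h <- hooks p) ((h%:R ^+ 2 + x) / h%:R ^+ 2).
  rewrite horner_sum; apply: eq_bigr => p _; rewrite horner_prod.
  by apply: eq_bigr => h _; rewrite !hornerE.
suff PQ : P - Q = 0 by rewrite -PE -QE (subr0_eq PQ).
(* The shift by [d + d] makes [hook_identity_square] applicable. *)
pose pt i : F := - ((i + d + d).+2 * (i + d + d).+2)%:R.
apply: (@roots_geq_poly_eq0 _ _ [seq pt i | i <- iota 0 (size (P - Q))]).
- apply/allP => _ /mapP[i _ ->].
  rewrite rootE hornerD hornerN PE QE subr_eq0; apply/eqP.
  by apply: hook_identity_square; lia.
- rewrite map_inj_uniq ?iota_uniq // => i j /oppr_inj/eqP; rewrite eqr_nat => /eqP.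
  by nia.
by rewrite size_map size_iota.
Qed.

Theorem mainTheorem1 (R : realType) (n : nat) (hn : (0 < n)%N) (z : R[i]) :
  \sum_(p : intpart n) \prod_(h <- hooks_trivial_leg p) ((h%:R + z) / h%:R)
  = \sum_(p : intpart n) \prod_(h <- hooks p) ((h%:R ^+ 2 + z) / h%:R ^+ 2).
Proof. exact: hook_identity. Qed.
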